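(* Let $\mathscr{C}$ be a rigid monoidal category. If $\mathscr{C}$ admits a central Hopf monad $\mathfrak{D}(\mathscr{C})$ and an anti-central comodule monad $\mathfrak{Q}(\mathscr{C})$, then $\mathscr{C}$ is pivotal if and only if $\mathfrak{D}(\mathscr{C})\cong\mathfrak{Q}(\mathscr{C})$ as monads.
   Context: Associators and unitors are suppressed; ${}^\vee x$ denotes the left dual of $x$. $\mathscr{C}$ is pivotal if there is a monoidal natural isomorphism $\mathrm{Id}_{\mathscr{C}}\Rightarrow{}^{\vee\vee}(-)$. An endofunctor $T$ of $\mathscr{C}$ is centralisable if the coend $Z_T(x)=\int^{y\in\mathscr{C}}{}^\vee(Ty)\otimes x\otimes y$ exists for all $x\in\mathscr{C}$. Then there is a universal coaction $\chi_{x,y}=(\mathrm{id}_{Ty}\otimes\mathrm{copr}_{y,x})\circ(\mathrm{coev}_{Ty}\otimes\mathrm{id}_{x\otimes y})\colon x\otimes y\to Ty\otimes Z_Tx$, where $\mathrm{coev}_{Ty}\colon1\to Ty\otimes{}^\vee(Ty)$ and $\mathrm{copr}_{y,x}\colon{}^\vee(Ty)\otimes x\otimes y\to Z_Tx$ is the coend structure map. If $T$ is oplax monoidal with structure maps $T_2,T_0$, then $Z_T$ is a monad with unit $(T_0\otimes Z_Tx)\circ\chi_{x,1}$ and multiplication $\mu_x\colon Z_T^2x\to Z_Tx$ uniquely determined by $(Ty\otimes Tz\otimes\mu_x)\circ(Ty\otimes\chi_{Z_Tx,z})\circ(\chi_{x,y}\otimes z)=(T_{2;y,z}\otimes Z_Tx)\circ\chi_{x,y\otimes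 z}$. $\mathscr{C}$ admits a central Hopf monad if $\mathrm{Id}_{\mathscr{C}}$ is centralisable, and then $\mathfrak{D}(\mathscr{C})=Z_{\mathrm{Id}}$. $\mathscr{C}$ admits an anti-central comodule monad if moreover the double left dual functor ${}^{\vee\vee}(-)$ (strong monoidal) is centralisable, and then $\mathfrak{Q}(\mathscr{C})=Z_{{}^{\vee\vee}(-)}$. (They carry additional Hopf monad and comodule monad structures, not needed for the statement, which concerns only the underlying monads.) *)

(* Defs.v *)
From mathcomp Require Import ssreflect ssrfun ssrbool.

Set Implicit Arguments.
Unset Strict Implicit.
Unset Printing Implicit Defensive.

Declare Scope cat_scope.
Delimit Scope cat_scope with cat.
Local Open Scope cat_scope.

Reserved Notation "x ~> y" (at level 70, no associativity).
Reserved Notation "g ∘ f" (at level 50, left associativity).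
Reserved Notation "x ⊗ y" (at level 40, left associativity).
Reserved Notation "f ⊗₁ g" (at level 40, left associativity).
Reserved Notation "x ◁ f" (at level 41, right associativity).
Reserved Notation "f ▷ x" (at level 40, left associativity).

Record category := Category {
  ob :> Type;
  hom : ob -> ob -> Type;
  idm : forall x, hom x x;
  comp : forall x y z, hom y z -> hom x y -> hom x z;
  comp1m : forall x y (f : hom x y), comp (idm y) f = f;
  compm1 : forall x y (f : hom x y), comp f (idm x) = f;
  compA : forall x y z t (h : hom z t) (g : hom y z) (f : hom x y),
    comp h (comp g f) = comp (comp h g) f }.

Arguments idm {c} x.
Arguments comp {c x y z} _ _.

Notation "x ~> y" := (hom x y) : cat_scope.
Notation "g ∘ f" := (comp g f) : cat_scope.

Definition is_iso (C : category) (x y : C) (f : x ~> y) : Prop :=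
  exists g : y ~> x, g ∘ f = idm x /\ f ∘ g = idm y.

Record functor (C D : category) := Functor {
  fob :> C -> D;
  fmap : forall x y, x ~> y -> fob x ~> fob y;
  fmap1 : forall x, fmap (idm x) = idm (fob x);
  fmapM : forall x y z (g : y ~> z) (f : x ~> y),
    fmap (g ∘ f) = fmap g ∘ fmap f }.

Arguments fmap {C D} f {x y} _ : rename.

Definition natural (C D : category) (F G : functor C D)
    (t : forall x, F x ~> G x) : Prop :=
  forall x y (f : x ~> y), t y ∘ fmap F f = fmap G f ∘ t x.

Definition id_functor (C : category) : functor C C :=
  @Functor C C id (fun _ _ => id) (fun _ => erefl) (fun _ _ _ _ _ => erefl).

(* Functors from C^op x C to D, with the action on pairs of morphisms
   curried. *)
Record difunctor (C D : category) := Difunctor {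
  dob :> C -> C -> D;
  dmap : forall a a' b b', a' ~> a -> b ~> b' -> dob a b ~> dob a' b';
  dmap1 : forall a b, dmap (idm a) (idm b) = idm (dob a b);
  dmapM : forall a a' a'' b b' b'' (f' : a'' ~> a') (f : a' ~> a)
    (g' : b' ~> b'') (g : b ~> b'),
    dmap (f ∘ f') (g' ∘ g) = dmap f' g' ∘ dmap f g }.

Arguments dmap {C D} d {a a' b b'} _ _ : rename.

Definition cowedge (C D : category) (F : difunctor C D) (w : D)
    (p : forall y, F y y ~> w) : Prop :=
  forall y z (f : y ~> z),
    p y ∘ dmap F f (idm y) = p z ∘ dmap F (idm z) f.

Record coend (C D : category) (F : difunctor C D) := Coend {
  coend_ob :> D;
  copr : forall y, F y y ~> coend_ob;
  copr_cowedge : cowedge copr;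
  coend_desc : forall w (p : forall y, F y y ~> w),
    cowedge p -> coend_ob ~> w;
  coend_descE : forall w (p : forall y, F y y ~> w) (pP : cowedge p) y,
    coend_desc pP ∘ copr y = p y;
  coend_uniq : forall w (f g : coend_ob ~> w),
    (forall y, f ∘ copr y = g ∘ copr y) -> f = g }.

Record monad (C : category) := Monad {
  mfun :> functor C C;
  munit : forall x, x ~> mfun x;
  mmult : forall x, mfun (mfun x) ~> mfun x;
  munit_nat : forall x y (f : x ~> y), munit y ∘ f = fmap mfun f ∘ munit x;
  mmult_nat : forall x y (f : x ~> y),
    mmult y ∘ fmap mfun (fmap mfun f) = fmap mfun f ∘ mmult x;
  mmult_unitl : forall x, mmult x ∘ munit (mfun x) = idm (mfun x);
  mmult_unitr : forall x, mmult x ∘ fmap mfun (munit x) = idm (mfun x);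
  mmultA : forall x,
    mmult x ∘ mmult (mfun x) = mmult x ∘ fmap mfun (mmult x) }.

Definition monad_morphism (C : category) (M N : monad C)
    (t : forall x, M x ~> N x) : Prop :=
  [/\ natural t,
      forall x, t x ∘ munit M x = munit N x
    & forall x, t x ∘ mmult M x = mmult N x ∘ t (N x) ∘ fmap M (t x)].

(* The componentwise inverse of such a t is again a monad morphism. *)
Definition monads_isomorphic (C : category) (M N : monad C) : Prop :=
  exists t : forall x, M x ~> N x,
    monad_morphism t /\ forall x, is_iso (t x).

Record monoidal_category := MonoidalCategory {
  mcat :> category;
  tens : mcat -> mcat -> mcat;
  tensm : forall x x' y y' : mcat,
    x ~> x' -> y ~> y' -> tens x y ~> tens x' y';
  one : mcat;
  assoc : forall x y z, tens (tens x y) z ~> tens x (tens y z);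
  associ : forall x y z, tens x (tens y z) ~> tens (tens x y) z;
  lunit : forall x, tens one x ~> x;
  luniti : forall x, x ~> tens one x;
  runit : forall x, tens x one ~> x;
  runiti : forall x, x ~> tens x one;
  tensm1 : forall x y, tensm (idm x) (idm y) = idm (tens x y);
  tensmM : forall x x' x'' y y' y'' (f' : x' ~> x'') (f : x ~> x')
    (g' : y' ~> y'') (g : y ~> y'),
    tensm (f' ∘ f) (g' ∘ g) = tensm f' g' ∘ tensm f g;
  assoc_nat : forall x x' y y' z z' (f : x ~> x') (g : y ~> y') (h : z ~> z'),
    assoc x' y' z' ∘ tensm (tensm f g) h
    = tensm f (tensm g h) ∘ assoc x y z;
  lunit_nat : forall x y (f : x ~> y),
    lunit y ∘ tensm (idm one) f = f ∘ lunit x;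
  runit_nat : forall x y (f : x ~> y),
    runit y ∘ tensm f (idm one) = f ∘ runit x;
  assocK : forall x y z, associ x y z ∘ assoc x y z = idm _;
  associK : forall x y z, assoc x y z ∘ associ x y z = idm _;
  lunitK : forall x, luniti x ∘ lunit x = idm _;
  lunitiK : forall x, lunit x ∘ luniti x = idm _;
  runitK : forall x, runiti x ∘ runit x = idm _;
  runitiK : forall x, runit x ∘ runiti x = idm _;
  triangle : forall x y,
    tensm (idm x) (lunit y) ∘ assoc x one y = tensm (runit x) (idm y);
  pentagon : forall x y z t,
    tensm (idm x) (assoc y z t) ∘ assoc x (tens y z) t
      ∘ tensm (assoc x y z) (idm t)
    = assoc x y (tens z t) ∘ assoc (tens x y) z t }.

Arguments one {m} : rename.
Arguments assoc {m} x y z : rename.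
Arguments associ {m} x y z : rename.
Arguments lunit {m} x : rename.
Arguments luniti {m} x : rename.
Arguments runit {m} x : rename.
Arguments runiti {m} x : rename.

Notation "x ⊗ y" := (tens x y) : cat_scope.
Notation "f ⊗₁ g" := (tensm f g) : cat_scope.
Notation "x ◁ f" := (tensm (idm x) f) : cat_scope.
Notation "f ▷ x" := (tensm f (idm x)) : cat_scope.

Record oplax_functor (C : monoidal_category) := OplaxFunctor {
  ofun :> functor C C;
  opl2 : forall x y, ofun (x ⊗ y) ~> ofun x ⊗ ofun y;
  opl0 : ofun one ~> one;
  opl2_nat : forall x x' y y' (f : x ~> x') (g : y ~> y'),
    opl2 x' y' ∘ fmap ofun (f ⊗₁ g)
    = (fmap ofun f ⊗₁ fmap ofun g) ∘ opl2 x y;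
  opl2A : forall x y z,
    assoc _ _ _ ∘ (opl2 x y ▷ ofun z) ∘ opl2 (x ⊗ y) z
    = (ofun x ◁ opl2 y z) ∘ opl2 x (y ⊗ z) ∘ fmap ofun (assoc x y z);
  opl_unitl : forall x,
    lunit _ ∘ (opl0 ▷ ofun x) ∘ opl2 one x = fmap ofun (lunit x);
  opl_unitr : forall x,
    runit _ ∘ (ofun x ◁ opl0) ∘ opl2 x one = fmap ofun (runit x) }.

Arguments opl2 {C} o x y : rename.
Arguments opl0 {C} o : rename.

Definition monoidal_natural (C : monoidal_category) (S T : oplax_functor C)
    (t : forall x, S x ~> T x) : Prop :=
  [/\ natural t,
      forall x y, opl2 T x y ∘ t (x ⊗ y) = (t x ⊗₁ t y) ∘ opl2 S x y
    & opl0 T ∘ t one = opl0 S].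

(* [duality b a]: b is a left dual of a (and a is a right dual of b). *)
Record duality (C : monoidal_category) (b a : C) := Duality {
  ev : b ⊗ a ~> one;
  coev : one ~> a ⊗ b;
  snake_r : runit a ∘ (a ◁ ev) ∘ assoc a b a ∘ (coev ▷ a) ∘ luniti a = idm a;
  snake_l : lunit b ∘ (ev ▷ b) ∘ associ b a b ∘ (b ◁ coev) ∘ runiti b
    = idm b }.

(* Left and right duals are chosen as part of the structure; different
   choices are related by unique compatible isomorphisms. *)
Record rigid_category := RigidCategory {
  rcat :> monoidal_category;
  dual : rcat -> rcat;
  dualP : forall x, duality (dual x) x;
  rdual : rcat -> rcat;
  rdualP : forall x, duality x (rdual x) }.

Arguments dualP {r} x : rename.
Arguments rdualP {r} x : rename.

(* Syntactic, so that it never unfolds a definition to a composite. *)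
Ltac comp_left :=
  repeat match goal with
  | |- context [comp ?h (comp ?g ?f)] => rewrite (compA h g f)
  end.

Section MonoidalTheory.
Variable C : monoidal_category.
Implicit Types x y z t u v w a b : C.

Lemma rwr (x y y' z t : C) (h : z ~> t) (g : y ~> z) (f : x ~> y)
    (g' : y' ~> z) (f' : x ~> y') :
  g ∘ f = g' ∘ f' -> h ∘ g ∘ f = h ∘ g' ∘ f'.
Proof. by move=> E; rewrite -?compA E. Qed.

Lemma rwr1 (x y z t : C) (h : z ~> t) (g : y ~> z) (f : x ~> y)
    (k : x ~> z) :
  g ∘ f = k -> h ∘ g ∘ f = h ∘ k.
Proof. by move=> E; rewrite -?compA E. Qed.

Lemma rwrK (x y z : C) (h : y ~> z) (g : x ~> y) (f : y ~> x) :
  g ∘ f = idm y -> h ∘ g ∘ f = h.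
Proof. by move=> E; rewrite -?compA E compm1. Qed.

Lemma mono (x y z : C) (h : y ~> z) (k : z ~> y) (f g : x ~> y) :
  k ∘ h = idm y -> h ∘ f = h ∘ g -> f = g.
Proof.
by move=> K E; rewrite -[f]comp1m -[g]comp1m -K -?compA E.
Qed.

Lemma epi (x y z : C) (h : x ~> y) (k : y ~> x) (f g : y ~> z) :
  h ∘ k = idm y -> f ∘ h = g ∘ h -> f = g.
Proof. by move=> K E; rewrite -[f]compm1 -[g]compm1 -K ?compA E. Qed.

Lemma lwM a x y z (g : y ~> z) (f : x ~> y) :
  a ◁ (g ∘ f) = (a ◁ g) ∘ (a ◁ f).
Proof. by rewrite -tensmM comp1m. Qed.

Lemma rwM a x y z (g : y ~> z) (f : x ~> y) :
  (g ∘ f) ▷ a = (g ▷ a) ∘ (f ▷ a).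
Proof. by rewrite -tensmM comp1m. Qed.

Lemma swap x x' y y' (f : x ~> x') (g : y ~> y') :
  (f ▷ y') ∘ (x ◁ g) = (x' ◁ g) ∘ (f ▷ y).
Proof. by rewrite -!tensmM !comp1m !compm1. Qed.

Lemma tensml x x' y y' (f : x ~> x') (g : y ~> y') :
  f ⊗₁ g = (f ▷ y') ∘ (x ◁ g).
Proof. by rewrite -!tensmM comp1m compm1. Qed.

Lemma tensmr x x' y y' (f : x ~> x') (g : y ~> y') :
  f ⊗₁ g = (x' ◁ g) ∘ (f ▷ y).
Proof. by rewrite -!tensmM comp1m compm1. Qed.

Lemma assoc1 x x' y z (f : x ~> x') :
  assoc x' y z ∘ (f ▷ y ▷ z) = (f ▷ (y ⊗ z)) ∘ assoc x y z.
Proof. by rewrite assoc_nat tensm1. Qed.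

Lemma assoc2 x y y' z (f : y ~> y') :
  assoc x y' z ∘ ((x ◁ f) ▷ z) = (x ◁ (f ▷ z)) ∘ assoc x y z.
Proof. by rewrite assoc_nat. Qed.

Lemma assoc3 x y z z' (f : z ~> z') :
  assoc x y z' ∘ ((x ⊗ y) ◁ f) = (x ◁ (y ◁ f)) ∘ assoc x y z.
Proof. by rewrite -tensm1 assoc_nat. Qed.

Lemma associ1 x x' y z (f : x ~> x') :
  associ x' y z ∘ (f ▷ (y ⊗ z)) = (f ▷ y ▷ z) ∘ associ x y z.
Proof.
apply: (epi (associK x y z)); rewrite -?compA assocK compm1 -assoc1.
by rewrite compA assocK comp1m.
Qed.

Lemma associ2 x y y' z (f : y ~> y') :
  associ x y' z ∘ (x ◁ (f ▷ z)) = ((x ◁ f) ▷ z) ∘ associ x y z.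
Proof.
apply: (epi (associK x y z)); rewrite -?compA assocK compm1 -assoc2.
by rewrite compA assocK comp1m.
Qed.

Lemma associ3 x y z z' (f : z ~> z') :
  associ x y z' ∘ (x ◁ (y ◁ f)) = ((x ⊗ y) ◁ f) ∘ associ x y z.
Proof.
apply: (epi (associK x y z)); rewrite -?compA assocK compm1 -assoc3.
by rewrite compA assocK comp1m.
Qed.

Lemma luniti_nat x y (f : x ~> y) : (one ◁ f) ∘ luniti x = luniti y ∘ f.
Proof.
apply: (mono (lunitK y)).
by rewrite ?compA lunit_nat lunitiK comp1m -compA lunitiK compm1.
Qed.

Lemma runiti_nat x y (f : x ~> y) : (f ▷ one) ∘ runiti x = runiti y ∘ f.
Proof.
apply: (mono (runitK y)).
by rewrite ?compA runit_nat runitiK comp1m -compA runitiK compm1.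
Qed.

Lemma lwI x y (f g : x ~> y) : one ◁ f = one ◁ g -> f = g.
Proof.
move=> E; apply: (epi (lunitiK x)).
by rewrite -!lunit_nat E.
Qed.

Lemma rwI x y (f g : x ~> y) : f ▷ one = g ▷ one -> f = g.
Proof.
move=> E; apply: (epi (runitiK x)).
by rewrite -!runit_nat E.
Qed.

Lemma lwK a x y (g : y ~> x) (f : x ~> y) :
  g ∘ f = idm x -> (a ◁ g) ∘ (a ◁ f) = idm (a ⊗ x).
Proof. by move=> E; rewrite -lwM E tensm1. Qed.

Lemma rwK a x y (g : y ~> x) (f : x ~> y) :
  g ∘ f = idm x -> (g ▷ a) ∘ (f ▷ a) = idm (x ⊗ a).
Proof. by move=> E; rewrite -rwM E tensm1. Qed.

(* pentagon, solved for some of the two-associator composites *)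
Lemma pentagon1 x y z t :
  (assoc x y z ▷ t) ∘ associ (x ⊗ y) z t
  = associ x (y ⊗ z) t ∘ (x ◁ associ y z t) ∘ assoc x y (z ⊗ t).
Proof.
apply: (epi (associK (x ⊗ y) z t)).
rewrite -compA assocK compm1 -[RHS]compA -pentagon ?compA.
rewrite (rwrK _ (lwK x (assocK y z t))).
by rewrite assocK comp1m.
Qed.

Lemma pentagon2 x y z t :
  (x ◁ associ y z t) ∘ assoc x y (z ⊗ t)
  = assoc x (y ⊗ z) t ∘ (assoc x y z ▷ t) ∘ associ (x ⊗ y) z t.
Proof. by rewrite -compA pentagon1 ?compA associK comp1m. Qed.

Lemma pentagon4 x y z t :
  associ x (y ⊗ z) t ∘ (x ◁ associ y z t)
  = (assoc x y z ▷ t) ∘ associ (x ⊗ y) z t ∘ associ x y (z ⊗ t).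
Proof. by rewrite pentagon1 rwrK // associK. Qed.

Lemma pentagon5 x y z t :
  (associ x y z ▷ t) ∘ associ x (y ⊗ z) t
  = associ (x ⊗ y) z t ∘ associ x y (z ⊗ t) ∘ (x ◁ assoc y z t).
Proof.
apply: (epi (lwK x (assocK y z t))).
rewrite -compA pentagon4 ?compA (rwK t (assocK x y z)) comp1m.
by rewrite (rwrK _ (lwK x (associK y z t))).
Qed.

Lemma pentagon6 x y z t :
  (x ◁ assoc y z t) ∘ assoc x (y ⊗ z) t
  = assoc x y (z ⊗ t) ∘ assoc (x ⊗ y) z t ∘ (associ x y z ▷ t).
Proof. by rewrite -pentagon (rwrK _ (rwK t (associK x y z))). Qed.

Lemma pentagon7 x y z t :
  (x ◁ associ y z t) ∘ assoc x y (z ⊗ t) ∘ assoc (x ⊗ y) z t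
  = assoc x (y ⊗ z) t ∘ (assoc x y z ▷ t).
Proof. by rewrite pentagon2 rwrK // assocK. Qed.

Lemma triangle1 x y : (runit x ▷ y) ∘ associ x one y = x ◁ lunit y.
Proof. by rewrite -triangle -compA associK compm1. Qed.

Lemma triangle2 x y : assoc x one y ∘ (runiti x ▷ y) = x ◁ luniti y.
Proof.
apply: (mono (h := x ◁ lunit y)); first exact/lwK/lunitK.
rewrite compA triangle (rwK y (runitiK x)).
by rewrite (lwK x (lunitiK y)).
Qed.

Lemma triangle3 x y : associ x one y ∘ (x ◁ luniti y) = runiti x ▷ y.
Proof. by rewrite -triangle2 compA assocK comp1m. Qed.

Lemma rwr3 (x y z t u : C) (h : t ~> u) (g1 : z ~> t) (g2 : y ~> z)
    (g3 : x ~> y) (k : x ~> t) :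
  g1 ∘ g2 ∘ g3 = k -> h ∘ g1 ∘ g2 ∘ g3 = h ∘ k.
Proof. by move=> E; rewrite -?compA -E ?compA. Qed.

Lemma kelly_l x y : lunit (x ⊗ y) ∘ assoc one x y = lunit x ▷ y.
Proof.
apply: lwI.
apply: (epi (h := assoc one (one ⊗ x) y ∘ (assoc one one x ▷ y))
            (k := (associ one one x ▷ y) ∘ associ one (one ⊗ x) y)).
  rewrite compA rwrK; last exact/rwK/associK.
  exact: associK.
rewrite lwM ?compA (rwr3 _ (pentagon _ _ _ _)) ?compA triangle.
rewrite -assoc2 -compA -rwM triangle -assoc1 ?tensm1 //.
Qed.

Lemma kelly_r x y : (x ◁ runit y) ∘ assoc x y one = runit (x ⊗ y).
Proof.
apply: rwI; apply: (mono (assocK x y one)).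
rewrite rwM compA assoc2 -triangle lwM.
by rewrite (rwr3 _ (pentagon _ _ _ _)) compA -assoc3 -compA triangle.
Qed.

Lemma unitE : lunit (one : C) = runit one.
Proof.
apply: rwI; rewrite -kelly_l -triangle.
congr (_ ∘ _); apply: (mono (lunitK one)).
by rewrite -lunit_nat.
Qed.

Lemma unitiE : luniti (one : C) = runiti one.
Proof.
apply: (mono (h := lunit one)); first exact: lunitK.
by rewrite lunitiK unitE runitiK.
Qed.

Lemma kelly_li x y : assoc one x y ∘ (luniti x ▷ y) = luniti (x ⊗ y).
Proof.
apply: (mono (lunitK (x ⊗ y))); rewrite compA kelly_l lunitiK.
exact/rwK/lunitiK.
Qed.

Lemma kelly_li' x y : associ one x y ∘ luniti (x ⊗ y) = luniti x ▷ y.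
Proof. by rewrite -kelly_li compA assocK comp1m. Qed.

Lemma kelly_ri x y : assoc x y one ∘ runiti (x ⊗ y) = x ◁ runiti y.
Proof.
apply: (mono (h := x ◁ runit y)); first exact/lwK/runitK.
by rewrite compA kelly_r runitiK (lwK x (runitiK y)).
Qed.

Lemma kelly_l' x y : (lunit x ▷ y) ∘ associ one x y = lunit (x ⊗ y).
Proof. by rewrite -kelly_l -compA associK compm1. Qed.

End MonoidalTheory.

Section Duality.
Variables (C : monoidal_category) (b a : C) (d : duality b a).
Implicit Types u v w : C.

(* b ⊗ - is left adjoint to a ⊗ -, and - ⊗ a is left adjoint to - ⊗ b. *)

Definition lcurry u w (f : b ⊗ u ~> w) : u ~> a ⊗ w :=
  (a ◁ f) ∘ assoc a b u ∘ (coev d ▷ u) ∘ luniti u.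

Definition luncurry u w (g : u ~> a ⊗ w) : b ⊗ u ~> w :=
  lunit w ∘ (ev d ▷ w) ∘ associ b a w ∘ (b ◁ g).

Definition rcurry u w (f : u ⊗ a ~> w) : u ~> w ⊗ b :=
  (f ▷ b) ∘ associ u a b ∘ (u ◁ coev d) ∘ runiti u.

Definition runcurry u w (g : u ~> w ⊗ b) : u ⊗ a ~> w :=
  runit w ∘ (w ◁ ev d) ∘ assoc w b a ∘ (g ▷ a).

Definition mate w (g : one ~> a ⊗ w) : b ~> w := luncurry g ∘ runiti b.

Lemma snake_rL w :
  (a ◁ lunit w) ∘ (a ◁ (ev d ▷ w)) ∘ (a ◁ associ b a w)
    ∘ assoc a b (a ⊗ w) ∘ (coev d ▷ (a ⊗ w)) ∘ luniti (a ⊗ w)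
  = idm (a ⊗ w).
Proof.
rewrite -[RHS]tensm1 -[in RHS](snake_r d) !rwM -kelly_li' ?compA.
rewrite (rwr _ (esym (associ1 _ _ _))) ?compA.
rewrite (rwr1 _ (pentagon1 _ _ _ _)) ?compA.
by rewrite (rwr _ (esym (associ2 _ _ _))) triangle1.
Qed.

Lemma snake_lL u :
  lunit (b ⊗ u) ∘ (ev d ▷ (b ⊗ u)) ∘ associ b a (b ⊗ u)
    ∘ (b ◁ assoc a b u) ∘ (b ◁ (coev d ▷ u)) ∘ (b ◁ luniti u)
  = idm (b ⊗ u).
Proof.
rewrite -[RHS]tensm1 -[in RHS](snake_l d) !rwM -triangle3 ?compA.
rewrite (rwr _ (esym (associ2 _ _ _))) ?compA.
rewrite (rwr1 _ (pentagon5 _ _ _ _)) ?compA.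
by rewrite (rwr _ (esym (associ1 _ _ _))) kelly_l'.
Qed.

Lemma snake_rR u :
  runit (u ⊗ a) ∘ ((u ⊗ a) ◁ ev d) ∘ assoc (u ⊗ a) b a
    ∘ (associ u a b ▷ a) ∘ ((u ◁ coev d) ▷ a) ∘ (runiti u ▷ a)
  = idm (u ⊗ a).
Proof.
rewrite -[RHS]tensm1 -[in RHS](snake_r d) !lwM -triangle2 ?compA.
rewrite (rwr _ (esym (assoc2 _ _ _))) ?compA.
rewrite (rwr1 _ (pentagon6 _ _ _ _)) ?compA.
by rewrite (rwr _ (esym (assoc3 _ _ _))) kelly_r.
Qed.

Lemma luncurryK u w (g : u ~> a ⊗ w) : lcurry (luncurry g) = g.
Proof.
rewrite /lcurry /luncurry !lwM (rwr _ (esym (assoc3 _ _ _))).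
rewrite (rwr _ (esym (swap _ _))) -compA luniti_nat compA.
by rewrite snake_rL comp1m.
Qed.

Lemma lcurryK u w (f : b ⊗ u ~> w) : luncurry (lcurry f) = f.
Proof.
rewrite /lcurry /luncurry !lwM ?compA (rwr _ (associ3 _ _ _)) ?compA.
rewrite (rwr _ (swap _ _)) lunit_nat -[RHS]compm1 -[in RHS]snake_lL.
by rewrite ?compA.
Qed.

Lemma rcurryK u w (f : u ⊗ a ~> w) : runcurry (rcurry f) = f.
Proof.
rewrite /rcurry /runcurry !rwM ?compA (rwr _ (assoc1 _ _ _)) ?compA.
rewrite (rwr _ (esym (swap _ _))) ?compA runit_nat -[RHS]compm1 -[in RHS]snake_rR.
by rewrite ?compA.
Qed.

Lemma snake_lR w :
  (runit w ▷ b) ∘ ((w ◁ ev d) ▷ b) ∘ (assoc w b a ▷ b)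
    ∘ associ (w ⊗ b) a b ∘ ((w ⊗ b) ◁ coev d) ∘ runiti (w ⊗ b)
  = idm (w ⊗ b).
Proof.
rewrite -[RHS]tensm1 -[in RHS](snake_l d) !lwM -kelly_ri ?compA.
rewrite (rwr _ (esym (assoc3 _ _ _))) ?compA.
rewrite (rwr1 _ (pentagon2 _ _ _ _)) ?compA.
by rewrite (rwr _ (esym (assoc2 _ _ _))) triangle.
Qed.

Lemma runcurryK u w (g : u ~> w ⊗ b) : rcurry (runcurry g) = g.
Proof.
rewrite /rcurry /runcurry !rwM (rwr _ (esym (associ1 _ _ _))).
rewrite (rwr _ (swap _ _)) -compA runiti_nat ?compA.
by rewrite snake_lR comp1m.
Qed.

Lemma rcurry_inj u w (f g : u ⊗ a ~> w) : rcurry f = rcurry g -> f = g.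
Proof. by move=> E; rewrite -[f]rcurryK E rcurryK. Qed.

Lemma lcurry_comp u w w' (h : w ~> w') (f : b ⊗ u ~> w) :
  lcurry (h ∘ f) = (a ◁ h) ∘ lcurry f.
Proof. by rewrite /lcurry lwM ?compA. Qed.

Lemma lcurry_pre u u' w (f : b ⊗ u ~> w) (h : u' ~> u) :
  lcurry (f ∘ (b ◁ h)) = lcurry f ∘ h.
Proof.
rewrite /lcurry lwM (rwr _ (esym (assoc3 _ _ _))).
rewrite (rwr _ (esym (swap _ _))).
by rewrite -compA luniti_nat compA.
Qed.

Lemma lcurry_inj u w (f g : b ⊗ u ~> w) : lcurry f = lcurry g -> f = g.
Proof. by move=> E; rewrite -[f]lcurryK E lcurryK. Qed.

Lemma lcurry_assoc u v w (h : b ⊗ (u ⊗ v) ~> w) :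
  lcurry h = (a ◁ (h ∘ assoc b u v)) ∘ assoc a (b ⊗ u) v
    ∘ (lcurry (idm (b ⊗ u)) ▷ v).
Proof.
rewrite /lcurry tensm1 comp1m lwM !rwM ?compA.
rewrite (rwr3 _ (pentagon _ _ _ _)) compA.
rewrite (rwr _ (assoc1 _ _ _)) ?compA.
by rewrite -[RHS]compA kelly_li.
Qed.

Lemma coev_lcurry w (k : b ~> w) :
  (a ◁ k) ∘ coev d = lcurry (k ∘ runit b).
Proof.
rewrite /lcurry lwM (rwr1 _ (kelly_r _ _)) (rwr1 _ (runit_nat _)) ?compA.
by rewrite unitiE rwrK // runitiK.
Qed.

Lemma mateK w (g : one ~> a ⊗ w) : (a ◁ mate g) ∘ coev d = g.
Proof.
rewrite coev_lcurry /mate rwrK; last exact: runitK.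
by rewrite luncurryK.
Qed.

Lemma mate_uniq w (h k : b ~> w) :
  (a ◁ h) ∘ coev d = (a ◁ k) ∘ coev d -> h = k.
Proof.
rewrite !coev_lcurry => /lcurry_inj.
exact: (epi (runitiK _)).
Qed.

End Duality.

Section RcurryWhisker.
Variables (C : monoidal_category) (b a : C) (d : duality b a).

Lemma rcurry_whisker (e t u w : C) (g : t ⊗ a ~> w) (h : u ~> e ⊗ t) :
  rcurry d ((e ◁ g) ∘ assoc e t a ∘ (h ▷ a))
  = associ e w b ∘ (e ◁ rcurry d g) ∘ h.
Proof.
rewrite /rcurry !rwM !lwM ?compA.
rewrite (rwr _ (esym (associ1 _ _ _))) (rwr _ (swap _ _)).
rewrite (rwr _ (runiti_nat _)) (rwr1 _ (pentagon1 _ _ _ _)) ?compA.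
rewrite (rwr _ (assoc3 _ _ _)) (rwr1 _ (kelly_ri _ _)).
by rewrite (esym (associ2 _ _ _)).
Qed.

End RcurryWhisker.

Section DualFunctor.
Variable C : rigid_category.
Implicit Types x y z u w : C.

Notation coevx x := (coev (dualP x)).
Notation L y := (lcurry (dualP y)).

(* The mate characterises each of the following maps out of a dual by its
   composite with the coevaluation: see dual_mapE, dual_tensE, dual_unitE. *)
Definition dual_map x y (f : x ~> y) : dual y ~> dual x :=
  mate (dualP y) ((f ▷ dual x) ∘ coevx x).

(* The canonical comparison: (x ⊗ y) ⊗ dual_tens x y turns coev_(x ⊗ y) into
   the coevaluation of y nested inside that of x. *)
Definition dual_tens x y : dual (x ⊗ y) ~> dual y ⊗ dual x :=
  mate (dualP (x ⊗ y))
    (associ x y _ ∘ (x ◁ L y (idm (dual y ⊗ dual x))) ∘ coevx x).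

Definition dual_tensi x y : dual y ⊗ dual x ~> dual (x ⊗ y) :=
  luncurry (dualP y) (mate (dualP x) (assoc x y _ ∘ coevx (x ⊗ y))).

Definition dual_unit : dual (one : C) ~> one := mate (dualP one) (luniti one).

Definition dual_uniti : one ~> dual (one : C) := lunit _ ∘ coevx one.

Lemma dual_mapE x y (f : x ~> y) :
  (y ◁ dual_map f) ∘ coevx y = (f ▷ dual x) ∘ coevx x.
Proof. exact: mateK. Qed.

Lemma dual_map1 x : dual_map (idm x) = idm (dual x).
Proof. by apply: (mate_uniq (d := dualP x)); rewrite dual_mapE. Qed.

Lemma dual_mapM x y z (g : y ~> z) (f : x ~> y) :
  dual_map (g ∘ f) = dual_map f ∘ dual_map g.
Proof.
apply: (mate_uniq (d := dualP z)); rewrite dual_mapE lwM.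
rewrite (rwr1 _ (dual_mapE _)); comp_left; rewrite -swap (rwr1 _ (dual_mapE _)).
by comp_left; rewrite rwM.
Qed.

Lemma dual_tensE x y w (h : dual y ⊗ dual x ~> w) :
  assoc x y w ∘ ((x ⊗ y) ◁ (h ∘ dual_tens x y)) ∘ coevx (x ⊗ y)
  = (x ◁ L y h) ∘ coevx x.
Proof.
rewrite lwM; comp_left; rewrite (rwr1 _ (mateK _ _)); comp_left; rewrite assoc3.
rewrite (rwrK _ (associK _ _ _)) -lwM -lcurry_comp compm1 //.
Qed.

Lemma dual_tensiE x y :
  (x ◁ L y (dual_tensi x y)) ∘ coevx x = assoc x y _ ∘ coevx (x ⊗ y).
Proof. by rewrite luncurryK mateK. Qed.

(* dual_tensi is inverse to dual_tens, and dual_uniti to dual_unit. *)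
Lemma dual_tensiK x y : dual_tens x y ∘ dual_tensi x y = idm _.
Proof.
apply: (lcurry_inj (d := dualP y)); apply: (mate_uniq (d := dualP x)).
rewrite lcurry_comp lwM (rwr1 _ (dual_tensiE _ _)); comp_left; rewrite -assoc3.
by rewrite -(dual_tensE (idm _)) comp1m.
Qed.

Lemma dual_tensK x y : dual_tensi x y ∘ dual_tens x y = idm _.
Proof.
apply: (mate_uniq (d := dualP (x ⊗ y))); apply: (mono (assocK _ _ _)).
by comp_left; rewrite dual_tensE dual_tensiE tensm1 compm1.
Qed.

Lemma lcurry_whisker y u w (k : dual y ~> w) :
  L y (k ▷ u) = assoc y w u ∘ (((y ◁ k) ∘ coevx y) ▷ u) ∘ luniti u.
Proof. by rewrite /lcurry rwM; comp_left; rewrite assoc2. Qed.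

Lemma dual_tens_nat x x' y y' (f : x ~> x') (g : y ~> y') :
  (dual_map g ⊗₁ dual_map f) ∘ dual_tens x' y'
  = dual_tens x y ∘ dual_map (f ⊗₁ g).
Proof.
apply: (mate_uniq (d := dualP (x' ⊗ y'))); apply: (mono (assocK _ _ _)).
comp_left; rewrite dual_tensE lwM; comp_left.
rewrite (rwr1 _ (dual_mapE _)); comp_left.
rewrite (rwr _ (esym (swap _ _))) -[idm (dual y ⊗ _)]tensm1 assoc_nat.
have := dual_tensE (idm (dual y ⊗ dual x)).
rewrite comp1m => /rwr3 ->; comp_left.
rewrite tensm1 -tensmM compm1 [in RHS]tensmr (rwr1 _ (esym (dual_mapE _))).
comp_left; rewrite -lwM; congr ((_ ◁ _) ∘ _).
rewrite tensml lcurry_pre; congr (_ ∘ _).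
rewrite lcurry_whisker dual_mapE rwM; comp_left; rewrite assoc1.
by rewrite /lcurry tensm1 comp1m; comp_left.
Qed.

Lemma lcurry_dual_tens y z u w (h : (dual z ⊗ dual y) ⊗ u ~> w) :
  assoc y z w ∘ L (y ⊗ z) (h ∘ (dual_tens y z ▷ u))
  = L y (L z (h ∘ associ (dual z) (dual y) u)).
Proof.
rewrite lcurry_comp lcurry_whisker.
have -> : ((y ⊗ z) ◁ dual_tens y z) ∘ coevx (y ⊗ z)
    = associ y z _ ∘ ((y ◁ L z (idm (dual z ⊗ dual y))) ∘ coevx y).
  by rewrite mateK; comp_left.
comp_left; rewrite assoc3 !rwM; comp_left.
rewrite (rwr3 _ (esym (pentagon6 _ _ _ _))); comp_left.
rewrite (rwr _ (assoc2 _ _ _)) [L z (h ∘ _)]lcurry_assoc.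
rewrite (rwrK h (assocK _ _ _)) [RHS]/(lcurry _ _) /lcurry !lwM; comp_left.
by [].
Qed.

Lemma dual_tensA x y z :
  (dual z ◁ dual_tens x y) ∘ dual_tens (x ⊗ y) z ∘ dual_map (assoc x y z)
  = assoc _ _ _ ∘ (dual_tens y z ▷ dual x) ∘ dual_tens x (y ⊗ z).
Proof.
apply: (mate_uniq (d := dualP (x ⊗ (y ⊗ z)))).
apply: (mono (assocK _ _ _)).
apply: (mono (h := x ◁ assoc _ _ _)); first exact/lwK/assocK.
comp_left; rewrite [RHS](rwr3 _ (dual_tensE _)); comp_left.
rewrite -lwM lcurry_dual_tens associK.
rewrite lwM; comp_left; rewrite (rwr1 _ (dual_mapE _)); comp_left.
rewrite (rwr _ (esym (swap _ _))).
rewrite pentagon (rwr3 _ (dual_tensE _)); comp_left.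
by rewrite -[_ ◁ dual_tens x y]comp1m lcurry_pre dual_tensE.
Qed.

Lemma dual_unitE : (one ◁ dual_unit) ∘ coevx one = luniti one.
Proof. exact: mateK. Qed.

Lemma dual_unitiK : dual_unit ∘ dual_uniti = idm one.
Proof.
by rewrite /dual_uniti; comp_left; rewrite -lunit_nat -compA dual_unitE lunitiK.
Qed.

Lemma dual_unitK : dual_uniti ∘ dual_unit = idm (dual one).
Proof.
apply: (mate_uniq (d := dualP one)).
rewrite lwM -compA dual_unitE luniti_nat /dual_uniti; comp_left.
by rewrite lunitK tensm1.
Qed.

Lemma dual_tens_unitl x :
  runit _ ∘ (dual x ◁ dual_unit) ∘ dual_tens one x = dual_map (luniti x).
Proof.
apply: (mate_uniq (d := dualP (one ⊗ x))); apply: (mono (assocK _ _ _)).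
comp_left; rewrite dual_tensE (rwr1 _ (dual_mapE _)); comp_left.
rewrite kelly_li lcurry_pre lwM -compA dual_unitE.
by rewrite luniti_nat -[runit _]comp1m -coev_lcurry tensm1 comp1m.
Qed.

Lemma dual_tens_unitr x :
  lunit _ ∘ (dual_unit ▷ dual x) ∘ dual_tens x one = dual_map (runiti x).
Proof.
apply: (mate_uniq (d := dualP (x ⊗ one))); apply: (mono (assocK _ _ _)).
comp_left; rewrite dual_tensE (rwr1 _ (dual_mapE _)); comp_left.
rewrite triangle2; congr ((_ ◁ _) ∘ _).
rewrite lcurry_comp lcurry_whisker dual_unitE; comp_left.
by rewrite (rwr1 _ (kelly_li _ _)) luniti_nat (rwrK _ (lunitiK _)).
Qed.

Lemma dual_tensi_nat x x' y y' (f : x ~> x') (g : y ~> y') :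
  dual_map (f ⊗₁ g) ∘ dual_tensi x' y'
  = dual_tensi x y ∘ (dual_map g ⊗₁ dual_map f).
Proof.
apply: (mono (dual_tensK x y)); comp_left.
rewrite -dual_tens_nat rwrK ?dual_tensiK ?comp1m //.
Qed.

Lemma dual_tensiA x y z :
  dual_map (assoc x y z) ∘ dual_tensi x (y ⊗ z) ∘ (dual_tensi y z ▷ dual x)
  = dual_tensi (x ⊗ y) z ∘ (dual z ◁ dual_tensi x y) ∘ assoc _ _ _.
Proof.
apply: (mono (dual_tensK (x ⊗ y) z)).
apply: (mono (lwK (dual z) (dual_tensK x y))).
comp_left; rewrite dual_tensA (rwrK _ (dual_tensiK _ _)).
rewrite (rwrK _ (rwK _ (dual_tensiK _ _))) (rwrK _ (dual_tensiK _ _)).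
by rewrite (lwK _ (dual_tensiK _ _)) comp1m.
Qed.

Lemma dual_tensi_unitl x :
  dual_tensi one x ∘ (dual x ◁ dual_uniti) ∘ runiti _ = dual_map (lunit x).
Proof.
apply: (mono (h := dual_map (luniti x)) (k := dual_map (lunit x))).
  by rewrite -dual_mapM lunitK dual_map1.
rewrite -dual_mapM lunitiK dual_map1 -dual_tens_unitl; comp_left.
rewrite (rwrK _ (dual_tensiK _ _)) (rwrK _ (lwK _ dual_unitiK)).
exact: runitiK.
Qed.

Lemma dual_tensi_unitr x :
  dual_tensi x one ∘ (dual_uniti ▷ dual x) ∘ luniti _ = dual_map (runit x).
Proof.
apply: (mono (h := dual_map (runiti x)) (k := dual_map (runit x))).
  by rewrite -dual_mapM runitK dual_map1.
rewrite -dual_mapM runitiK dual_map1 -dual_tens_unitr; comp_left.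
rewrite (rwrK _ (dual_tensiK _ _)) (rwrK _ (rwK _ dual_unitiK)).
exact: lunitiK.
Qed.

Lemma lcurry_dual_map y y' u w (g : y ~> y') (p : dual y ⊗ u ~> w) :
  (g ▷ w) ∘ L y p = L y' (p ∘ (dual_map g ▷ u)).
Proof.
rewrite lcurry_comp lcurry_whisker dual_mapE rwM; comp_left.
by rewrite (rwr _ (assoc1 _ _ _)) -swap /lcurry; comp_left.
Qed.

Definition double_dual_functor : functor C C :=
  @Functor C C (fun x => dual (dual x))
    (fun x y f => dual_map (dual_map f))
    (fun x => etrans (congr1 _ (dual_map1 x)) (dual_map1 _))
    (fun x y z g f => etrans (congr1 _ (dual_mapM g f)) (dual_mapM _ _)).

(* The contravariant strong monoidal structure of dual, applied twice. *)
Definition double_dual2 x y :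
    dual (dual (x ⊗ y)) ~> dual (dual x) ⊗ dual (dual y) :=
  dual_tens (dual y) (dual x) ∘ dual_map (dual_tensi x y).

Definition double_dual0 : dual (dual (one : C)) ~> one :=
  dual_unit ∘ dual_map dual_uniti.

Lemma double_dual2_nat x x' y y' (f : x ~> x') (g : y ~> y') :
  double_dual2 x' y' ∘ dual_map (dual_map (f ⊗₁ g))
  = (dual_map (dual_map f) ⊗₁ dual_map (dual_map g)) ∘ double_dual2 x y.
Proof.
rewrite /double_dual2; comp_left; rewrite dual_tens_nat.
by rewrite !(rwr1 _ (esym (dual_mapM _ _))) dual_tensi_nat.
Qed.

Lemma double_dual2A x y z :
  assoc _ _ _ ∘ (double_dual2 x y ▷ dual (dual z)) ∘ double_dual2 (x ⊗ y) z
  = (dual (dual x) ◁ double_dual2 y z) ∘ double_dual2 x (y ⊗ z)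
    ∘ dual_map (dual_map (assoc x y z)).
Proof.
rewrite /double_dual2 rwM lwM; comp_left.
rewrite -[in LHS]dual_map1 (rwr _ (dual_tens_nat _ _)) !dual_map1.
rewrite -[in RHS]dual_map1 (rwr _ (dual_tens_nat _ _)) !dual_map1.
rewrite -dual_tensA !(rwr1 _ (esym (dual_mapM _ _))); comp_left.
by rewrite dual_tensiA.
Qed.

Lemma double_dual_unitl x :
  lunit _ ∘ (double_dual0 ▷ dual (dual x)) ∘ double_dual2 one x
  = dual_map (dual_map (lunit x)).
Proof.
rewrite /double_dual2 /double_dual0 rwM; comp_left.
rewrite -[in LHS]dual_map1 (rwr _ (dual_tens_nat _ _)) !dual_map1.
rewrite dual_tens_unitr -!dual_mapM; comp_left.
by rewrite -dual_tensi_unitl; comp_left.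
Qed.

Lemma double_dual_unitr x :
  runit _ ∘ (dual (dual x) ◁ double_dual0) ∘ double_dual2 x one
  = dual_map (dual_map (runit x)).
Proof.
rewrite /double_dual2 /double_dual0 lwM; comp_left.
rewrite -[in LHS]dual_map1 (rwr _ (dual_tens_nat _ _)) !dual_map1.
rewrite dual_tens_unitl -!dual_mapM; comp_left.
by rewrite -dual_tensi_unitr; comp_left.
Qed.

Lemma double_dual2_iso x y : is_iso (double_dual2 x y).
Proof.
exists (dual_map (dual_tens x y) ∘ dual_tensi (dual y) (dual x)).
rewrite /double_dual2; comp_left; split.
  rewrite (rwrK _ (dual_tensK _ _)) -dual_mapM dual_tensK.
  exact: dual_map1.
rewrite (rwrK (dual_tens _ _) (_ : dual_map _ ∘ dual_map _ = idm _)).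
  exact: dual_tensiK.
by rewrite -dual_mapM dual_tensiK dual_map1.
Qed.

Lemma double_dual0_iso : is_iso double_dual0.
Proof.
exists (dual_map dual_unit ∘ dual_uniti).
rewrite /double_dual0; comp_left; split.
  rewrite (rwrK _ dual_unitK) -dual_mapM dual_unitK.
  exact: dual_map1.
rewrite (rwrK dual_unit (_ : dual_map _ ∘ dual_map _ = idm _)).
  exact: dual_unitiK.
by rewrite -dual_mapM dual_unitiK dual_map1.
Qed.

Definition double_dual : oplax_functor C :=
  @OplaxFunctor C double_dual_functor double_dual2 double_dual0
    double_dual2_nat double_dual2A double_dual_unitl double_dual_unitr.

End DualFunctor.

Section Central.
Variables (C : rigid_category) (T : functor C C).
Implicit Types x y z v w : C.

(* (a, b) |-> ^(T a) ⊗ x ⊗ b *)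
Definition central_difunctor x : difunctor C C.
Proof.
refine (@Difunctor C C (fun a b => dual (T a) ⊗ (x ⊗ b))
  (fun a a' b b' f g => dual_map (fmap T f) ⊗₁ (x ◁ g)) _ _).
- by move=> a b; rewrite fmap1 dual_map1 !tensm1.
- by move=> a a' a'' b b' b'' f' f g' g; rewrite fmapM dual_mapM lwM tensmM.
Defined.

Definition centralisable : Type := forall x, coend (central_difunctor x).

Variable Z : centralisable.

(* The coend copr is bracketed as ^(T y) ⊗ (x ⊗ y) -> Z x. *)
Definition coaction x y : x ⊗ y ~> T y ⊗ Z x :=
  (T y ◁ copr (Z x) y) ∘ assoc _ _ _ ∘ (coev (dualP (T y)) ▷ (x ⊗ y))
    ∘ luniti (x ⊗ y).

Lemma coaction_nat x y y' (f : y ~> y') :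
  (fmap T f ▷ Z x) ∘ coaction x y = coaction x y' ∘ (x ◁ f).
Proof.
rewrite [coaction x y]/(lcurry _ _) lcurry_dual_map.
rewrite [coaction x y']/(lcurry _ _) -lcurry_pre; congr lcurry.
have := copr_cowedge (Z x) f.
by rewrite /= tensm1 fmap1 dual_map1.
Qed.

Section Factor.
Variables (x w : C) (p : forall y, x ⊗ y ~> T y ⊗ w).
Hypothesis pP : forall y y' (f : y ~> y'),
  (fmap T f ▷ w) ∘ p y = p y' ∘ (x ◁ f).

Lemma luncurry_cowedge :
  cowedge (F := central_difunctor x)
    (fun y => luncurry (dualP (T y)) (p y)).
Proof.
move=> y z f /=; rewrite tensm1 fmap1 dual_map1.
apply: (lcurry_inj (d := dualP (T z))).
by rewrite -lcurry_dual_map lcurry_pre !luncurryK.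
Qed.

Definition central_desc : Z x ~> w := coend_desc (Z x) luncurry_cowedge.

Lemma central_descE y : (T y ◁ central_desc) ∘ coaction x y = p y.
Proof.
rewrite [coaction x y]/(lcurry _ _) -lcurry_comp.
rewrite (coend_descE (Z x) luncurry_cowedge y : central_desc ∘ _ = _).
exact: luncurryK.
Qed.

End Factor.

Lemma central_uniq x w (f g : Z x ~> w) :
  (forall y, (T y ◁ f) ∘ coaction x y = (T y ◁ g) ∘ coaction x y) -> f = g.
Proof.
move=> E; apply: (@coend_uniq _ _ _ (Z x)) => y.
apply: (lcurry_inj (d := dualP (T y))); rewrite !lcurry_comp.
exact: E.
Qed.

Lemma central_map_cowedge x x' (f : x ~> x') :
  cowedge (F := central_difunctor x)
    (fun y => copr (Z x') y ∘ (dual (T y) ◁ (f ▷ y))).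
Proof.
move=> y z g; have := copr_cowedge (Z x') g.
rewrite /= !tensm1 fmap1 !dual_map1 => E.
rewrite (rwr _ (esym (swap _ _))) E -!compA -!lwM.
by rewrite swap.
Qed.

Definition central_map x x' (f : x ~> x') : Z x ~> Z x' :=
  coend_desc (Z x) (central_map_cowedge f).

Lemma coaction_natl x x' y (f : x ~> x') :
  (T y ◁ central_map f) ∘ coaction x y = coaction x' y ∘ (f ▷ y).
Proof.
rewrite [coaction x y]/(lcurry _ _) -lcurry_comp.
rewrite (coend_descE (Z x) (central_map_cowedge f) y : central_map f ∘ _ = _).
exact: lcurry_pre.
Qed.

Lemma central_map1 x : central_map (idm x) = idm (Z x).
Proof.
by apply: central_uniq => y; rewrite coaction_natl !tensm1 compm1 comp1m.
Qed.

Lemma central_mapM x x' x'' (g : x' ~> x'') (f : x ~> x') :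
  central_map (g ∘ f) = central_map g ∘ central_map f.
Proof.
apply: central_uniq => y; rewrite coaction_natl lwM.
rewrite (rwr1 _ (coaction_natl _ _)); comp_left.
by rewrite coaction_natl rwM; comp_left.
Qed.

Definition central_functor : functor C C :=
  Functor central_map1 central_mapM.

Section Factor2.
Variables (x z v : C) (p : forall y, x ⊗ y ⊗ z ~> T y ⊗ v).
Hypothesis pP : forall y y' (f : y ~> y'),
  (fmap T f ▷ v) ∘ p y = p y' ∘ ((x ◁ f) ▷ z).

Lemma rcurry_coaction_nat y y' (f : y ~> y') :
  (fmap T f ▷ (v ⊗ dual z))
    ∘ (assoc (T y) v (dual z) ∘ rcurry (dualP z) (p y))
  = assoc (T y') v (dual z) ∘ rcurry (dualP z) (p y') ∘ (x ◁ f).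
Proof.
comp_left; rewrite -assoc1 -!compA; congr (_ ∘ _).
rewrite /rcurry; comp_left; rewrite -rwM pP rwM.
by rewrite (rwr _ (esym (associ1 _ _ _))) (rwr _ (swap _ _)) (rwr _ (runiti_nat _)).
Qed.

Definition central_desc2 : Z x ⊗ z ~> v :=
  runcurry (dualP z) (central_desc rcurry_coaction_nat).

Lemma central_desc2E y :
  (T y ◁ central_desc2) ∘ assoc _ _ _ ∘ (coaction x y ▷ z) = p y.
Proof.
apply: (rcurry_inj (d := dualP z)); rewrite rcurry_whisker runcurryK.
rewrite -compA central_descE; comp_left.
by rewrite assocK comp1m.
Qed.

End Factor2.

Lemma central_uniq2 x z v (f g : Z x ⊗ z ~> v) :
  (forall y, (T y ◁ f) ∘ assoc _ _ _ ∘ (coaction x y ▷ z)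
     = (T y ◁ g) ∘ assoc _ _ _ ∘ (coaction x y ▷ z)) -> f = g.
Proof.
move=> E; apply: (rcurry_inj (d := dualP z)); apply: central_uniq => y.
apply: (mono (associK _ _ _)); comp_left.
by rewrite -!rcurry_whisker E.
Qed.

End Central.

Section CentralMonad.
Variables (C : rigid_category) (T : oplax_functor C) (Z : centralisable T).
Implicit Types x y z v w : C.

Notation chi := (coaction Z).

Definition central_unit x : x ~> Z x :=
  lunit _ ∘ (opl0 T ▷ Z x) ∘ chi x one ∘ runiti x.

(* central_mult is the unique morphism satisfying central_multE, by
   central_mult_uniq. *)
Definition double_coaction x y z : x ⊗ y ⊗ z ~> T y ⊗ (T z ⊗ Z x) :=
  assoc _ _ _ ∘ (opl2 T y z ▷ Z x) ∘ chi x (y ⊗ z) ∘ assoc x y z.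

Lemma double_coaction_nat1 x z y y' (f : y ~> y') :
  (fmap T f ▷ (T z ⊗ Z x)) ∘ double_coaction x y z
  = double_coaction x y' z ∘ ((x ◁ f) ▷ z).
Proof.
rewrite /double_coaction; comp_left; rewrite -assoc1 (rwr _ (assoc2 _ _ _)).
rewrite (rwr _ (esym (coaction_nat _ _ _))).
rewrite [in LHS](rwr1 _ (esym (rwM _ _ _))) [in RHS](rwr1 _ (esym (rwM _ _ _))).
by rewrite opl2_nat fmap1.
Qed.

Lemma double_coaction_nat2 x y z z' (g : z ~> z') :
  (T y ◁ (fmap T g ▷ Z x)) ∘ double_coaction x y z
  = double_coaction x y z' ∘ ((x ⊗ y) ◁ g).
Proof.
rewrite /double_coaction; comp_left; rewrite -assoc2 (rwr _ (assoc3 _ _ _)).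
rewrite (rwr _ (esym (coaction_nat _ _ _))).
rewrite [in LHS](rwr1 _ (esym (rwM _ _ _))) [in RHS](rwr1 _ (esym (rwM _ _ _))).
by rewrite opl2_nat fmap1.
Qed.

Definition central_mult_pre x z : Z x ⊗ z ~> T z ⊗ Z x :=
  central_desc2 Z (@double_coaction_nat1 x z).

Lemma central_mult_preE x y z :
  (T y ◁ central_mult_pre x z) ∘ assoc _ _ _ ∘ (chi x y ▷ z)
  = double_coaction x y z.
Proof. exact: central_desc2E. Qed.

Lemma central_mult_pre_nat x z z' (g : z ~> z') :
  (fmap T g ▷ Z x) ∘ central_mult_pre x z
  = central_mult_pre x z' ∘ (Z x ◁ g).
Proof.
apply: (central_uniq2 (Z := Z)) => y.
rewrite [in LHS]lwM [in RHS]lwM (rwr3 _ (central_mult_preE _ _ _)).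
rewrite double_coaction_nat2 -central_mult_preE.
by rewrite -(rwr _ (assoc3 _ _ _)) (rwr _ (swap _ _)).
Qed.

Definition central_mult x : Z (Z x) ~> Z x :=
  central_desc Z (@central_mult_pre_nat x).

Lemma central_multE0 x z :
  (T z ◁ central_mult x) ∘ chi (Z x) z = central_mult_pre x z.
Proof. exact: central_descE. Qed.

Lemma central_multE x y z :
  (T y ◁ (T z ◁ central_mult x)) ∘ (T y ◁ chi (Z x) z) ∘ assoc _ _ _
    ∘ (chi x y ▷ z)
  = assoc _ _ _ ∘ (opl2 T y z ▷ Z x) ∘ chi x (y ⊗ z) ∘ assoc x y z.
Proof. by rewrite -lwM central_multE0 central_mult_preE. Qed.

Lemma central_mult_uniq x w (f g : Z (Z x) ~> w) :
  (forall y z,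
    (T y ◁ ((T z ◁ f) ∘ chi (Z x) z)) ∘ assoc _ _ _ ∘ (chi x y ▷ z)
    = (T y ◁ ((T z ◁ g) ∘ chi (Z x) z)) ∘ assoc _ _ _ ∘ (chi x y ▷ z)) ->
  f = g.
Proof.
move=> E; apply: (central_uniq (Z := Z)) => z.
by apply: (central_uniq2 (Z := Z)) => y; exact: E.
Qed.

Lemma double_coaction_natl x x' y z (f : x ~> x') :
  (T y ◁ (T z ◁ central_map Z f)) ∘ double_coaction x y z
  = double_coaction x' y z ∘ (f ▷ y ▷ z).
Proof.
rewrite /double_coaction; comp_left; rewrite -assoc3 (rwr _ (assoc1 _ _ _)).
by rewrite -(rwr _ (coaction_natl _ _ _)) (rwr _ (swap _ _)).
Qed.

Lemma central_unit_nat x x' (f : x ~> x') :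
  central_unit x' ∘ f = central_map Z f ∘ central_unit x.
Proof.
rewrite /central_unit; comp_left; rewrite -lunit_nat (rwr _ (esym (swap _ _))).
by rewrite (rwr _ (coaction_natl _ _ _)) (rwr _ (runiti_nat _)).
Qed.

Lemma central_mult_nat x x' (f : x ~> x') :
  central_mult x' ∘ central_map Z (central_map Z f)
  = central_map Z f ∘ central_mult x.
Proof.
apply: central_mult_uniq => y z.
rewrite [T z ◁ (central_mult x' ∘ _)]lwM (rwr1 _ (coaction_natl _ _ _)).
comp_left; rewrite central_multE0 [in LHS]lwM (rwr _ (esym (assoc2 _ _ _))).
rewrite (rwr1 _ (esym (rwM _ _ _))) coaction_natl [in LHS]rwM; comp_left.
rewrite central_mult_preE [T z ◁ (_ ∘ central_mult x)]lwM.
rewrite (rwr1 _ (central_multE0 _ _)) lwM (rwr3 _ (central_mult_preE _ _ _)).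
by rewrite double_coaction_natl.
Qed.

Lemma central_mult_unitl x : central_mult x ∘ central_unit (Z x) = idm (Z x).
Proof.
apply: (central_uniq (Z := Z)) => y; rewrite tensm1 comp1m.
have -> : central_mult x ∘ central_unit (Z x)
    = lunit _ ∘ (opl0 T ▷ Z x) ∘ central_mult_pre x one ∘ runiti _.
  rewrite /central_unit; comp_left; rewrite -lunit_nat (rwr _ (esym (swap _ _))).
  by rewrite (rwr1 _ (central_multE0 _ _)).
rewrite [T y ◁ (_ ∘ runiti _)]lwM -kelly_ri; comp_left.
rewrite (rwr _ (esym (runiti_nat _))); comp_left.
rewrite [T y ◁ (_ ∘ central_mult_pre x one)]lwM.
rewrite (rwr3 _ (central_mult_preE _ _ _)) /double_coaction; comp_left.
rewrite (rwr1 _ (kelly_ri _ _)) (rwr _ (esym (coaction_nat _ _ _))).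
rewrite lwM (rwr _ (esym (assoc2 _ _ _))) triangle.
rewrite -!rwM opl_unitr -fmapM runitiK fmap1 tensm1 comp1m.
by [].
Qed.

Lemma central_mult_unitr x :
  central_mult x ∘ central_map Z (central_unit x) = idm (Z x).
Proof.
apply: (central_uniq (Z := Z)) => z; rewrite tensm1 comp1m.
rewrite lwM (rwr1 _ (coaction_natl _ _ _)); comp_left; rewrite central_multE0.
rewrite /central_unit 2!rwM [(_ ∘ (opl0 T ▷ _)) ▷ z]rwM; comp_left.
rewrite -kelly_l; comp_left; rewrite -lunit_nat.
rewrite (rwr _ (assoc1 _ _ _)) (rwr _ (esym (swap _ _))).
rewrite (rwr3 _ (central_mult_preE _ _ _)) /double_coaction; comp_left.
rewrite (rwr1 _ (triangle2 _ _)) (rwr _ (esym (coaction_nat _ _ _))).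
rewrite (rwr _ (esym (assoc1 _ _ _))) kelly_l.
rewrite -!rwM opl_unitl -fmapM lunitiK fmap1 tensm1 comp1m.
by [].
Qed.

Lemma central_multA x :
  central_mult x ∘ central_mult (Z x)
  = central_mult x ∘ central_map Z (central_mult x).
Proof.
apply: (central_uniq (Z := Z)) => z.
apply: (central_uniq2 (Z := Z)) => y.
apply: (epi (assocK _ _ _)).
apply: (central_uniq2 (Z := Z)) => t.
apply: (epi (associK _ _ _)).
have -> : (T y ◁ ((T z ◁ (central_mult x ∘ central_mult (Z x)))
      ∘ chi (Z (Z x)) z)) ∘ assoc _ _ _ ∘ (chi (Z x) y ▷ z)
    ∘ associ _ _ _
    = assoc _ _ _ ∘ (opl2 T y z ▷ Z x) ∘ central_mult_pre x (y ⊗ z).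
  rewrite [T z ◁ _]lwM (rwr1 _ (central_multE0 _ _)) lwM.
  rewrite (rwr3 _ (central_mult_preE _ _ _)) /double_coaction; comp_left.
  rewrite (rwrK _ (associK _ _ _)) -assoc3 (rwr _ (esym (swap _ _))).
  by rewrite (rwr1 _ (central_multE0 _ _)).
have -> : (T y ◁ ((T z ◁ (central_mult x ∘ central_map Z (central_mult x)))
      ∘ chi (Z (Z x)) z)) ∘ assoc _ _ _ ∘ (chi (Z x) y ▷ z)
    ∘ associ _ _ _
    = (T y ◁ central_mult_pre x z) ∘ assoc _ _ _
      ∘ (central_mult_pre x y ▷ z) ∘ associ _ _ _.
  rewrite [T z ◁ _]lwM (rwr1 _ (coaction_natl _ _ _)); comp_left.
  rewrite central_multE0 lwM (rwr _ (esym (assoc2 _ _ _))).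
  by rewrite (rwr1 _ (esym (rwM _ _ _))) central_multE0.
rewrite [T t ◁ (_ ∘ central_mult_pre x (y ⊗ z))]lwM.
rewrite (rwr3 _ (central_mult_preE _ _ _)) /double_coaction; comp_left.
rewrite [in LHS](rwr1 _ (esym (pentagon _ _ _ _))); comp_left.
rewrite (rwr _ (esym (coaction_nat _ _ _))) lwM (rwr _ (esym (assoc2 _ _ _))).
have E := congr1 (fun f => f ▷ Z x) (opl2A T t y z).
rewrite !rwM in E; rewrite (rwr3 _ (esym E)); comp_left; rewrite pentagon.
rewrite (rwr _ (esym (assoc1 _ _ (chi x t)))).
rewrite [T t ◁ (_ ∘ associ _ _ _)]lwM (rwr3 _ (pentagon7 _ _ _ _)); comp_left.
rewrite [T t ◁ (_ ∘ (central_mult_pre x y ▷ z))]lwM.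
rewrite (rwr _ (esym (assoc2 _ _ (central_mult_pre x y)))).
have {}E := congr1 (fun f => f ▷ z) (central_mult_preE x t y).
rewrite [in LHS]rwM [_ ▷ z in LHS]rwM in E; rewrite (rwr3 _ E).
rewrite /double_coaction 3!rwM; comp_left.
rewrite [T t ◁ (_ ∘ assoc _ _ _)]lwM (rwr3 _ (pentagon _ _ _ _)); comp_left.
rewrite -assoc3 [in RHS](rwr _ (assoc1 _ _ (opl2 T t y))) (rwr _ (esym (swap _ _))).
rewrite [in RHS](rwr3 _ (central_mult_preE _ _ _)) /double_coaction; comp_left.
by rewrite [in LHS](rwr _ (assoc1 _ _ _)).
Qed.

Definition central_monad : monad C :=
  @Monad C (central_functor Z) central_unit central_mult central_unit_nat
    central_mult_nat central_mult_unitl central_mult_unitr central_multA.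

End CentralMonad.

Definition id_oplax (C : monoidal_category) : oplax_functor C.
Proof.
refine (@OplaxFunctor C (id_functor C) (fun _ _ => idm _) (idm _) _ _ _ _).
- by move=> x x' y y' f g; rewrite comp1m compm1.
- by move=> x y z; rewrite !tensm1 !compm1 comp1m.
- by move=> x; rewrite tensm1 !compm1.
- by move=> x; rewrite tensm1 !compm1.
Defined.

Definition pivotal (C : rigid_category) : Prop :=
  exists t : forall x : C, x ~> dual (dual x),
    monoidal_natural (S := id_oplax C) (T := double_dual C) t
    /\ forall x, is_iso (t x).

(* An element of each of the next two types is a choice of the coends whose
   existence is required; only the underlying monad of the central Hopf monad
   and of the anti-central comodule monad is recorded. *)
Definition admits_central_hopf_monad (C : rigid_category) : Type :=
  centralisable (id_oplax C).

Definition admits_anticentral_comodule_monad (C : rigid_category) : Type :=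
  centralisable (double_dual C).

Definition central_hopf_monad (C : rigid_category)
    (Z : admits_central_hopf_monad C) : monad C :=
  central_monad Z.

Definition anticentral_comodule_monad (C : rigid_category)
    (Z : admits_anticentral_comodule_monad C) : monad C :=
  central_monad Z.

(* Main.v *)
From mathcomp Require Import ssreflect ssrfun ssrbool.
Require Import Defs.

(** An algebra over Z_T on x amounts, by the universal property of the coend,
    to a half-braiding x ⊗ y -> T y ⊗ x twisted by T; so algebras of the
    central monad form the Drinfeld centre, and algebras of the anti-central
    monad form its twist by the double dual. For x the unit object, a twisted
    half-braiding is just a family y -> T y, and the algebra axioms say exactly
    that this family is monoidal: algebras over Z_T on the unit are the monoidal
    transformations from the identity to T ([unit_algebraP]).

    If the two monads are isomorphic, the algebra on the unit given by the
    identity transformation is carried along the isomorphism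
    ([algebra_transport]) to an algebra over the anti-central monad, which is a
    monoidal transformation t from the identity to the double dual. Rigidity
    makes t invertible: as it respects the pairing of the dual of x with x, the
    inverse at x is obtained by transposing the component of t at the dual of x
    ([rigid_inverseK], [rigid_inverseV]).

    Conversely, T |-> Z_T is contravariant: a monoidal transformation S -> T
    induces a morphism of monads Z_T -> Z_S by acting on the coaction
    ([central_pull_morphism]), and inverse transformations induce inverse
    morphisms. A pivotal structure and its inverse therefore give the required
    isomorphism. The inverse is again taken from the transposition formula,
    which yields all its components at once without choosing them. *)

Set Implicit Arguments.
Unset Strict Implicit.
Unset Printing Implicit Defensive.
Local Open Scope cat_scope.

(** * Algebras over isomorphic monads *)

Definition algebra (C : category) (M : monad C) (x : C) (a : M x ~> x) : Prop :=
  a ∘ munit M x = idm x /\ a ∘ mmult M x = a ∘ fmap M a.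

(** A morphism of monads pulls algebras back, so this is pulling back along the
    inverse of f. As only an inverse g of f at x is given, the multiplicativity of
    a ∘ g is checked after composing with the epimorphism
    f (N x) ∘ M (f x), where it becomes that of a. *)
Lemma algebra_transport (C : category) (M N : monad C)
    (f : forall x, M x ~> N x) (x : C) (a : M x ~> x) (g : N x ~> M x) :
  monad_morphism f -> (forall y, is_iso (f y)) ->
  g ∘ f x = idm (M x) -> algebra a -> algebra (a ∘ g).
Proof.
move=> [fnat funit fmult] fiso gK [a1 aM].
have agK : a ∘ g ∘ f x = a by rewrite -compA gK compm1.
split; first by rewrite -funit compA agK.
have [h [_ hK]] := fiso (N x); have [k [_ kK]] := fiso x.
have epiP : f (N x) ∘ fmap M (f x) ∘ (fmap M k ∘ h) = idm (N (N x)).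
  rewrite compA -[_ ∘ fmap M (f x) ∘ fmap M k]compA -fmapM kK fmap1 compm1.
  exact: hK.
suff E : a ∘ g ∘ mmult N x ∘ (f (N x) ∘ fmap M (f x))
    = a ∘ g ∘ fmap N (a ∘ g) ∘ (f (N x) ∘ fmap M (f x)).
  by rewrite -[LHS]compm1 -[RHS]compm1 -epiP compA E -compA.
rewrite -[LHS]compA [mmult N x ∘ _]compA -fmult compA agK aM.
rewrite -[RHS]compA [fmap N _ ∘ (_ ∘ _)]compA -fnat.
rewrite -[f x ∘ _ ∘ _]compA -fmapM agK compA.
by rewrite agK.
Qed.

(** * Algebras on the unit object as monoidal transformations *)

Section UnitAlgebra.
Variables (C : rigid_category) (T : oplax_functor C) (Z : centralisable T).

Notation chi := (coaction Z).

(** The twisted half-braiding (T y ◁ q) ∘ chi of q, read through the unitors as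
    a family y -> T y. *)
Definition corresponds (q : Z one ~> one) (t : forall y, y ~> T y) : Prop :=
  forall y, (T y ◁ q) ∘ chi one y = runiti (T y) ∘ t y ∘ lunit y.

Definition transformation_of (q : Z one ~> one) (y : C) : y ~> T y :=
  runit (T y) ∘ (T y ◁ q) ∘ chi one y ∘ luniti y.

Lemma transformation_ofP q : corresponds q (transformation_of q).
Proof.
move=> y; rewrite /transformation_of; comp_left.
by rewrite runitK comp1m (rwrK _ (lunitK y)).
Qed.

Lemma transformation_of_nat q :
  natural (F := id_functor C) (G := T) (transformation_of q).
Proof.
move=> x y f; rewrite /transformation_of /=; comp_left.
rewrite (rwr _ (esym (luniti_nat f))) (rwr _ (esym (coaction_nat Z one f))).
by rewrite (rwr _ (esym (swap _ _))) runit_nat.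
Qed.

Lemma corresponding_algebra (t : forall y, y ~> T y) :
  natural (F := id_functor C) (G := T) t -> exists q, corresponds q t.
Proof.
move=> tnat.
have pP y y' (f : y ~> y') :
    (fmap T f ▷ one) ∘ (runiti (T y) ∘ t y ∘ lunit y)
    = runiti (T y') ∘ t y' ∘ lunit y' ∘ (one ◁ f).
  comp_left; rewrite runiti_nat (rwr1 _ (lunit_nat f)); comp_left.
  by rewrite (rwr _ (tnat _ _ f)).
by exists (central_desc Z pP) => y; rewrite central_descE.
Qed.

(** Evaluated on the coactions, the unit axiom for q compares opl0 ∘ t with the
    identity, and the two sides of the multiplication axiom become
    opl2 ∘ t (x ⊗ y) and t x ⊗ t y, up to unitors. This tests the
    multiplication axiom fully, since maps out of Z (Z one) are determined by
    their values on double coactions. *)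
Lemma unit_algebraP (q : Z one ~> one) (t : forall y, y ~> T y) :
  natural (F := id_functor C) (G := T) t -> corresponds q t ->
  algebra (M := central_monad Z) q <->
  monoidal_natural (S := id_oplax C) (T := T) t.
Proof.
move=> tnat qt.
have unitE : q ∘ central_unit Z one = opl0 T ∘ t one.
  rewrite /central_unit; comp_left; rewrite -lunit_nat.
  rewrite (rwr _ (esym (swap _ _))) (rwr1 _ (qt one)); comp_left.
  rewrite (rwr _ (runiti_nat (opl0 T))) unitE runitiK comp1m.
  by rewrite (rwrK _ (runitiK _)).
have multE x y :
    (T x ◁ ((T y ◁ (q ∘ central_mult Z one)) ∘ chi (Z one) y)) ∘ assoc _ _ _
      ∘ (chi one x ▷ y)
    = (T x ◁ runiti (T y)) ∘ (opl2 T x y ∘ t (x ⊗ y)) ∘ (lunit x ▷ y).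
  rewrite [T y ◁ _]lwM (rwr1 _ (central_multE0 _ _ _)) lwM.
  rewrite (rwr3 _ (central_mult_preE _ _ _ _)).
  rewrite /double_coaction; comp_left; rewrite -assoc3 (rwr _ (esym (swap _ _))).
  rewrite (rwr1 _ (qt _)); comp_left; rewrite (rwr _ (runiti_nat _)).
  by rewrite (rwr1 _ (kelly_l _ _)) kelly_ri.
have mapE x y :
    (T x ◁ ((T y ◁ (q ∘ central_map Z q)) ∘ chi (Z one) y)) ∘ assoc _ _ _
      ∘ (chi one x ▷ y)
    = (T x ◁ runiti (T y)) ∘ (t x ⊗₁ t y) ∘ (lunit x ▷ y).
  rewrite [T y ◁ _]lwM (rwr1 _ (coaction_natl _ _ _)); comp_left; rewrite qt lwM.
  rewrite (rwr _ (esym (assoc2 _ _ _))) (rwr1 _ (esym (rwM _ _ _))) qt.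
  rewrite !lwM !rwM; comp_left.
  rewrite (rwr1 _ (triangle2 _ _)) (rwrK _ (lwK _ (lunitiK _))).
  by rewrite [t x ⊗₁ t y]tensmr; comp_left.
split.
  move=> [q1 qM]; split=> //; last by rewrite -unitE.
  move=> x y; rewrite /= compm1.
  apply: (mono (lwK (T x) (runitiK (T y)))).
  apply: (epi (rwK y (lunitiK x))).
  by rewrite -multE -mapE qM.
move=> [_ t2 t0]; split; first by rewrite -[LHS]/(q ∘ central_unit Z one) unitE.
apply: central_mult_uniq => x y; rewrite multE mapE.
by rewrite t2 /= compm1.
Qed.
End UnitAlgebra.

(** * Functoriality of the central monad *)

Section Pullback.
Variables (C : rigid_category) (S T : oplax_functor C).
Variables (ZS : centralisable S) (ZT : centralisable T).

Lemma pull_nat (t : forall y, S y ~> T y) (tnat : natural t) x y y' (f : y ~> y') :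
  (fmap T f ▷ ZS x) ∘ ((t y ▷ ZS x) ∘ coaction ZS x y)
  = (t y' ▷ ZS x) ∘ coaction ZS x y' ∘ (x ◁ f).
Proof.
comp_left; rewrite -rwM -tnat rwM -[RHS]compA -coaction_nat.
by comp_left.
Qed.

Definition central_pull (t : forall y, S y ~> T y) (tnat : natural t) x :
  ZT x ~> ZS x := central_desc ZT (@pull_nat t tnat x).

Variables (t : forall y, S y ~> T y) (tnat : natural t).
Notation pull := (central_pull tnat).

Lemma central_pullE x y :
  (T y ◁ pull x) ∘ coaction ZT x y = (t y ▷ ZS x) ∘ coaction ZS x y.
Proof. exact: central_descE. Qed.

(** The unit and multiplication of a central monad are built from opl0 and opl2
    inserted after the coaction, and t turns those of S into those of T. *)
Lemma central_pull_morphism :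
  monoidal_natural t ->
  monad_morphism (M := central_monad ZT) (N := central_monad ZS) pull.
Proof.
move=> [_ t2 t0]; split=> [x x' f|x|x] /=.
- apply: (central_uniq (Z := ZT)) => y; rewrite !lwM.
  rewrite (rwr1 _ (coaction_natl _ _ _)) (rwr1 _ (central_pullE _ _)); comp_left.
  by rewrite central_pullE -[LHS]compA -coaction_natl; comp_left; rewrite swap.
- rewrite /central_unit; comp_left; rewrite -lunit_nat (rwr _ (esym (swap _ _))).
  by rewrite (rwr1 _ (central_pullE _ _)); comp_left;
    rewrite (rwr1 _ (esym (rwM _ _ _))) t0.
apply: central_mult_uniq => y z.
rewrite [T z ◁ _ in LHS]lwM (rwr1 _ (central_multE0 _ _ _)) lwM.
rewrite (rwr3 _ (central_mult_preE _ _ _ _)).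
rewrite /double_coaction; comp_left; rewrite -assoc3 (rwr _ (esym (swap _ _))).
rewrite (rwr1 _ (central_pullE _ _)); comp_left.
rewrite (rwr1 _ (esym (rwM _ _ _))) t2 rwM; comp_left; rewrite assoc_nat.
rewrite [T z ◁ (_ ∘ central_map _ _)]lwM.
rewrite (rwr1 _ (coaction_natl _ _ _)); comp_left.
rewrite [T z ◁ (_ ∘ pull _)]lwM (rwr1 _ (central_pullE _ _)); comp_left.
rewrite -swap (rwr1 _ (central_multE0 _ _ _)) [in RHS]lwM.
rewrite (rwr _ (esym (assoc2 _ _ _))) (rwr1 _ (esym (rwM _ _ _))) central_pullE.
rewrite rwM [T y ◁ (_ ∘ central_mult_pre _ _ _)]lwM; comp_left.
rewrite (rwr _ (assoc1 _ _ _)) -(rwr _ (swap _ _)).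
rewrite (rwr3 _ (central_mult_preE _ _ _ _)) /double_coaction.
by rewrite [t y ⊗₁ _]tensmr; comp_left.
Qed.

End Pullback.

Lemma central_pullK (C : rigid_category) (S T : oplax_functor C)
    (ZS : centralisable S) (ZT : centralisable T)
    (t : forall y, S y ~> T y) (s : forall y, T y ~> S y)
    (tnat : natural t) (snat : natural s) :
  (forall y, s y ∘ t y = idm (S y)) ->
  forall x, central_pull ZS ZT tnat x ∘ central_pull ZT ZS snat x = idm (ZS x).
Proof.
move=> tK x; apply: (central_uniq (Z := ZS)) => y.
rewrite lwM (rwr1 _ (central_pullE _ _ _ _ _)); comp_left.
rewrite -swap (rwr1 _ (central_pullE _ _ _ _ _)); comp_left.
by rewrite -rwM tK !tensm1.
Qed.

(** * Inverting monoidal transformations by duality *)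

Lemma monoidal_natural_inverse (C : monoidal_category) (S T : oplax_functor C)
    (t : forall x, S x ~> T x) (s : forall x, T x ~> S x) :
  (forall x, s x ∘ t x = idm _) -> (forall x, t x ∘ s x = idm _) ->
  monoidal_natural t -> monoidal_natural s.
Proof.
move=> tK sK [tnat t2 t0]; split=> [x y f|x y|].
- apply: (mono (tK y)); apply: (epi (sK x)); comp_left.
  by rewrite sK comp1m tnat (rwrK _ (tK x)).
- have ttK : (s x ⊗₁ s y) ∘ (t x ⊗₁ t y) = idm _ by rewrite -tensmM !tK tensm1.
  apply: (mono ttK); apply: (epi (sK (x ⊗ y))); comp_left.
  by rewrite -t2 (rwrK _ (tK _)) -tensmM !sK tensm1 comp1m.
by rewrite -t0 rwrK.
Qed.

(** The pairing e is the image under T of the evaluation of x, transported along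
    opl2. For strong monoidal T it exhibits T (dual x) as a left dual of T x. *)
Section Inverse.
Variables (C : rigid_category) (T : oplax_functor C).
Variable e : forall x, T (dual x) ⊗ T x ~> one.
Hypothesis eE : forall x,
  e x ∘ opl2 T (dual x) x = opl0 T ∘ fmap T (ev (dualP x)).
Hypothesis opl0_iso : is_iso (opl0 T).
Variable t : forall x, x ~> T x.
Hypothesis tmon : monoidal_natural (S := id_oplax C) (T := T) t.

(** The transpose of t (dual x) with respect to the dualities of x and T x. *)
Definition rigid_inverse (x : C) : T x ~> x :=
  runit x ∘ lcurry (dualP x) (e x ∘ (t (dual x) ▷ T x)).

(** Monoidality of t turns e ∘ (t (dual x) ⊗ t x) into the evaluation of x, so
    that the composite collapses to a snake of x. *)
Lemma rigid_inverseK x : rigid_inverse x ∘ t x = idm x.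
Proof.
have [tnat t2 t0] := tmon.
rewrite /rigid_inverse -compA -lcurry_pre -[e x ∘ _ ∘ _]compA -tensml.
have -> : e x ∘ (t (dual x) ⊗₁ t x) = ev (dualP x).
  have /= := t2 (dual x) x; rewrite compm1 => <-; comp_left.
  rewrite eE -compA; have /= <- := tnat _ _ (ev (dualP x)).
  by comp_left; rewrite t0 /= comp1m.
by rewrite /lcurry; comp_left; exact: snake_r.
Qed.

(** T applied to the snake identity of x. The map t one appears as the inverse of
    opl0. *)
Lemma snake_image x :
  runit (T x) ∘ (T x ◁ e x) ∘ assoc _ _ _
    ∘ ((opl2 T x (dual x) ∘ fmap T (coev (dualP x)) ∘ t one) ▷ T x)
    ∘ luniti (T x) = idm (T x).
Proof.
have [tnat t2 t0] := tmon.
have t0K : t one ∘ opl0 T = idm (T one).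
  have [u [uK Ku]] := opl0_iso; apply: (mono uK).
  by rewrite compA [opl0 T ∘ _]t0 comp1m compm1.
have -> : luniti (T x)
    = (opl0 T ▷ T x) ∘ opl2 T one x ∘ fmap T (luniti x).
  apply: (mono (lunitK (T x))); comp_left.
  by rewrite lunitiK opl_unitl -fmapM lunitiK fmap1.
comp_left; rewrite (rwr1 _ (esym (rwM _ _ _))) -[_ ∘ t one ∘ opl0 T]compA t0K.
rewrite compm1 rwM; comp_left.
have N1 := opl2_nat T (coev (dualP x)) (idm x); rewrite fmap1 in N1.
rewrite (rwr _ (esym N1)) (rwr3 _ (opl2A T _ _ _)); comp_left.
rewrite (rwr1 _ (esym (lwM _ _ _))) eE lwM; comp_left.
have N2 := opl2_nat T (idm x) (ev (dualP x)); rewrite fmap1 in N2.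
rewrite (rwr _ (esym N2)) opl_unitr -!fmapM snake_r.
exact: fmap1.
Qed.

(** Monoidality of t turns (t x ⊗ t (dual x)) ∘ coev into the image of the
    coevaluation, so that the composite collapses to the snake of T x. *)
Lemma rigid_inverseV x : t x ∘ rigid_inverse x = idm (T x).
Proof.
have [tnat t2 t0] := tmon.
rewrite -[RHS]snake_image /rigid_inverse /lcurry; comp_left.
rewrite -runit_nat (rwr _ (swap _ _)) (rwr _ (esym (assoc1 _ _ _))) lwM; comp_left.
rewrite (rwr _ (esym (assoc2 _ _ _))) !(rwr1 _ (esym (rwM _ _ _))).
comp_left; rewrite -tensmr -[opl2 _ _ _ ∘ _ ∘ _]compA.
have /= <- := tnat _ _ (coev (dualP x)).
by comp_left; rewrite [opl2 _ _ _ ∘ _]t2 /= compm1.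
Qed.

End Inverse.

(** * The equivalence *)

(** The last two factors compose to the inverse of the structure map
    double_dual2 (dual x) x. *)
Definition double_dual_pairing (C : rigid_category) (x : C) :
    dual (dual (dual x)) ⊗ dual (dual x) ~> one :=
  double_dual0 C ∘ dual_map (dual_map (ev (dualP x)))
    ∘ dual_map (dual_tens (dual x) x) ∘ dual_tensi (dual x) (dual (dual x)).

Lemma double_dual_pairingE (C : rigid_category) (x : C) :
  double_dual_pairing x ∘ double_dual2 (dual x) x
  = double_dual0 C ∘ dual_map (dual_map (ev (dualP x))).
Proof.
rewrite /double_dual_pairing /double_dual2; comp_left.
rewrite (rwrK _ (dual_tensK _ _)) rwrK // -dual_mapM dual_tensK.
exact: dual_map1.
Qed.

Theorem corollary6p45 (C : rigid_category)
    (D : admits_central_hopf_monad C)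
    (Q : admits_anticentral_comodule_monad C) :
  pivotal C <->
  monads_isomorphic (central_hopf_monad D) (anticentral_comodule_monad Q).
Proof.
split=> [[t [tmon _]] | [f [fmor fiso]]].
  pose s := rigid_inverse (T := double_dual C) (@double_dual_pairing C) t.
  have sK x : s x ∘ t x = idm x.
    exact: (rigid_inverseK (T := double_dual C) (@double_dual_pairingE C) tmon x).
  have tK x : t x ∘ s x = idm (dual (dual x)).
    exact: (rigid_inverseV (T := double_dual C) (@double_dual_pairingE C)
              (double_dual0_iso C) tmon x).
  have smon := monoidal_natural_inverse (S := id_oplax C)
                 (T := double_dual C) sK tK tmon.
  have [tnat _ _] := tmon; have [snat _ _] := smon.
  exists (central_pull Q D snat); split; first exact: central_pull_morphism.
  move=> x; exists (central_pull D Q tnat x).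
  by split; apply: central_pullK.
(* The trivial half-braiding on the unit object, given by the identity
   transformation, is the algebra to transport. *)
have id_nat : natural (F := id_functor C) (G := id_oplax C) (fun x => idm x).
  by move=> x y g; rewrite compm1 comp1m.
have id_mon : monoidal_natural (S := id_oplax C) (T := id_oplax C)
    (fun x => idm x).
  by split=> // [x y|]; rewrite ?tensm1 compm1.
have [eps epsE] := corresponding_algebra D id_nat.
have [g [gK _]] := fiso one.
have eps_alg := (unit_algebraP id_nat epsE).2 id_mon.
have q_alg := algebra_transport fmor fiso gK eps_alg.
pose t := transformation_of (T := double_dual C) (Z := Q) (eps ∘ g).
have tnat := transformation_of_nat (Z := Q) (eps ∘ g).
have tE := transformation_ofP (Z := Q) (eps ∘ g).
have tmon := (unit_algebraP tnat tE).1 q_alg.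
exists t; split=> // x.
exists (rigid_inverse (T := double_dual C) (@double_dual_pairing C) t x); split.
  exact: (rigid_inverseK (T := double_dual C) (@double_dual_pairingE C) tmon x).
exact: (rigid_inverseV (T := double_dual C) (@double_dual_pairingE C)
          (double_dual0_iso C) tmon x).
Qed.
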